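(* Let $R$ be a commutative ring with identity such that $sr(R)\le 2$. Then a matrix in $\mathbb{M}_2(R)$ is extendable if and only if it is simply extendable (hence $R$ is an $SE_2$ ring if and only if it is an $E_2$ ring).
   Context: $(a_1,\dots,a_n)\in R^n$ is unimodular if $a_1,\dots,a_n$ generate the unit ideal; $Um(R^n)$ is the set of such tuples. $sr(R)$ (stable range) is the smallest $n\in\mathbb{N}=\{1,2,\dots\}$ such that for each $(a_1,\dots,a_n,b)\in Um(R^{n+1})$ there exists $(r_1,\dots,r_n)\in R^n$ with $(a_1+br_1,\dots,a_n+br_n)\in Um(R^n)$ (and $sr(R)=\infty$ if no such $n$ exists). A matrix in $\mathbb{M}_2(R)$ is unimodular if its four entries generate the unit ideal; $Um(\mathbb{M}_2(R))$ is the set of such matrices. A matrix $A\in\mathbb{M}_2(R)$ is extendable if there exists $A^+\in SL_3(R)$ whose upper-left $2\times 2$ block is $A$; it is simply extendable if moreover $A^+$ can be chosen with $(3,3)$ entry $0$. $R$ is an $E_2$ ring (resp. $SE_2$ ring) if each matrix in $Um(\mathbb{M}_2(R))$ is extendable (resp. simply extendable). *)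

(* Defs.v *)
From mathcomp Require Import all_boot all_algebra.

Set Implicit Arguments.
Unset Strict Implicit.
Unset Printing Implicit Defensive.

Import GRing.Theory.
Local Open Scope ring_scope.

(* Commutative rings are comPzRingType rather than comNzRingType: 1 <> 0 is
   not assumed. *)

Definition unimodular (R : comPzRingType) (n : nat) (a : 'rV[R]_n) : Prop :=
  exists c : 'rV[R]_n, \sum_(i < n) c 0 i * a 0 i = 1.

Definition unimodular_mx (R : comPzRingType) (A : 'M[R]_2) : Prop :=
  unimodular (mxvec A).

(* row_mx a b%:M is the tuple (a_1, ..., a_n, b). *)
Definition stable_at (R : comPzRingType) (n : nat) : Prop :=
  forall (a : 'rV[R]_n) (b : R), unimodular (row_mx a b%:M) ->
    exists r : 'rV[R]_n, unimodular (a + b *: r).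

(* sr(R) = n, for n finite. *)
Definition is_sr (R : comPzRingType) (n : nat) : Prop :=
  [/\ (0 < n)%N, stable_at R n &
      forall m : nat, (0 < m)%N -> stable_at R m -> (n <= m)%N].

Definition sr_le (R : comPzRingType) (k : nat) : Prop :=
  exists n : nat, is_sr R n /\ (n <= k)%N.

Definition extendable (R : comPzRingType) (A : 'M[R]_2) : Prop :=
  exists Ap : 'M[R]_(2 + 1), \det Ap = 1 /\ ulsubmx Ap = A.

Definition simply_extendable (R : comPzRingType) (A : 'M[R]_2) : Prop :=
  exists Ap : 'M[R]_(2 + 1),
    [/\ \det Ap = 1, ulsubmx Ap = A & Ap ord_max ord_max = 0].

Definition E2_ring (R : comPzRingType) : Prop :=
  forall A : 'M[R]_2, unimodular_mx A -> extendable A.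

Definition SE2_ring (R : comPzRingType) : Prop :=
  forall A : 'M[R]_2, unimodular_mx A -> simply_extendable A.

(* Main.v *)
Require Import Defs.
From mathcomp Require Import all_boot all_algebra ring.

Set Implicit Arguments.
Unset Strict Implicit.
Unset Printing Implicit Defensive.

Import GRing.Theory.
Local Open Scope ring_scope.

(** A matrix [A] is extendable iff [v * \det A - y (\adj A) x = 1] for some
  column [x], row [y] and scalar [v], the left-hand side being the determinant
  of [A] bordered by [x], [y] and [v] ([det_bordered_mx22]); it is simply
  extendable iff [y (\adj A) x = 1] for some [x] and [y].

  Put [w = (\adj A) x].  The first equation says that [(w_1, w_2, \det A)] is
  unimodular, so stable range at most 2 gives [r] such that [w + (\det A) r] is
  unimodular.  As [\det A] is the scalar matrix [(\adj A) A], this vector is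
  [(\adj A) (x + A r)]: replacing [x] by [x + A r] yields a solution of the
  second equation ([extendable_simply]).

  The stable range condition in size 1 implies the one in size 2
  ([stable_at1_2]), so a stable range at most 2 always provides the condition in
  size 2. *)

Lemma det_mx22 (R : comPzRingType) (A : 'M[R]_2) :
  \det A = A 0 0 * A 1 1 - A 0 1 * A 1 0.
Proof.
rewrite (expand_det_row _ 0) !big_ord_recl big_ord0 /cofactor !det_mx11 !mxE /=.
have -> : lift 0 0 = 1 :> 'I_2 by apply/val_inj.
have -> : lift 1 0 = 0 :> 'I_2 by apply/val_inj.
rewrite /bump /=.
ring.
Qed.

(** Indices are taken modulo 2, so that [1 - i] is the index other than [i]. *)
Lemma adj_mx22 (R : comPzRingType) (A : 'M[R]_2) (i j : 'I_2) :
  (\adj A) i j = if i == j then A (1 - i) (1 - j) else - A i j.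
Proof.
rewrite !mxE /cofactor !det_mx11 !mxE.
case: i => -[|[|//]] ?; case: j => -[|[|//]] ? /=;
  rewrite ?expr0 ?expr1 ?sqrr_sign ?expr2 ?mulN1r ?opprK ?mul1r.
all: by first [congr (- _) | idtac]; congr (A _ _); apply/val_inj.
Qed.

Lemma det_bordered_mx22 (R : comPzRingType) (A : 'M[R]_2) (x : 'cV[R]_2)
    (y : 'rV[R]_2) (v : R) :
  \det (block_mx A x y v%:M : 'M[R]_(2 + 1)) =
    v * \det A - (y *m \adj A *m x) 0 0.
Proof.
have ord2 : lift ord0 ord0 = 1 :> 'I_2 by apply/val_inj.
have ord0E : ord0 = 0 :> 'I_2 by [].
(* What is left of the row indices, and of the column indices, once one of them
  is deleted. *)
have lift0l : lift (lshift 1 (0 : 'I_2)) 0 = lshift 1 1 by apply/val_inj.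
have lift0r : lift (lshift 1 (0 : 'I_2)) 1 = rshift 2 0 by apply/val_inj.
have lift1l : lift (lshift 1 (1 : 'I_2)) 0 = lshift 1 0 by apply/val_inj.
have lift1r : lift (lshift 1 (1 : 'I_2)) 1 = rshift 2 0 by apply/val_inj.
have lift2 (i : 'I_2) : lift (rshift 2 (0 : 'I_1)) i = lshift 1 i.
  by apply/val_inj; case: i => -[|[|//]].
have minorE (M : 'M[R]_(2 + 1)) (i j : 'I_(2 + 1)) (k l : 'I_2) :
  row' i (col' j M) k l = M (lift i k) (lift j l) by rewrite !mxE.
rewrite (expand_det_col _ (rshift 2 ord0)) big_split_ord.
rewrite !big_ord_recl !big_ord0 /cofactor !det_mx22 !minorE !ord2.
rewrite !(lift0l, lift0r, lift1l, lift1r, lift2).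
rewrite !(block_mxEul, block_mxEur, block_mxEdl, block_mxEdr).
move: (\adj A) (@adj_mx22 R A) => B adjE.
rewrite !(mxE, big_ord_recl, big_ord0) !adjE !ord2 ord0E !subrr !subr0 /=.
ring.
Qed.

Lemma extendableP (R : comPzRingType) (A : 'M[R]_2) :
  extendable A <-> exists (x : 'cV[R]_2) (y : 'rV[R]_2) (v : R),
    v * \det A - (y *m \adj A *m x) 0 0 = 1.
Proof.
split=> [[Ap [detAp <-]] | [x [y [v detE]]]].
  exists (ursubmx Ap), (dlsubmx Ap), (drsubmx Ap 0 0).
  by rewrite -det_bordered_mx22 -mx11_scalar submxK.
by exists (block_mx A x y v%:M); rewrite det_bordered_mx22 block_mxKul.
Qed.

Lemma simply_extendableP (R : comPzRingType) (A : 'M[R]_2) :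
  simply_extendable A <-> exists (x : 'cV[R]_2) (y : 'rV[R]_2),
    (y *m \adj A *m x) 0 0 = 1.
Proof.
have corner : ord_max = rshift 2 (0 : 'I_1) by apply/val_inj.
split=> [[Ap [detAp <- Ap33]] | [x [y yAx]]].
  (* The sign turns [- y (\adj A) x = 1] into [y (\adj A) x = 1]. *)
  exists (ursubmx Ap), (- dlsubmx Ap).
  have dr0 : drsubmx Ap 0 0 = 0 by rewrite !mxE -corner.
  rewrite !mulNmx mxE -[LHS]add0r -[X in X - _](mul0r (\det (ulsubmx Ap))) -dr0.
  by rewrite -det_bordered_mx22 -mx11_scalar submxK.
exists (block_mx A x (- y) 0%:M); split.
- by rewrite det_bordered_mx22 mul0r !mulNmx mxE yAx sub0r opprK.
- by rewrite block_mxKul.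
- by rewrite corner block_mxEdr mxE.
Qed.

Lemma unimodular_row_mx_scalar (R : comPzRingType) (n : nat) (a : 'rV[R]_n)
    (b : R) :
  unimodular (row_mx a b%:M) <->
  exists (c : 'rV[R]_n) (d : R), \sum_(i < n) c 0 i * a 0 i + d * b = 1.
Proof.
have splitE (c : 'rV[R]_n) (d : 'rV[R]_1) :
    \sum_(i < n + 1) row_mx c d 0 i * row_mx a b%:M 0 i =
    \sum_(i < n) c 0 i * a 0 i + d 0 0 * b.
  rewrite big_split_ord big_ord1 !row_mxEr [b%:M _ _]mxE.
  by congr (_ + _); apply: eq_bigr => i _; rewrite !row_mxEl.
split=> [[c sum1] | [c [d sum1]]].
  by exists (lsubmx c), (rsubmx c 0 0); rewrite -splitE hsubmxK.
by exists (row_mx c d%:M); rewrite splitE [d%:M _ _]mxE.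
Qed.

(** Given [c0 a0 + c1 a1 + d b = 1], the condition in size 1 applied to
  [(a0, c1 a1 + d b)] gives [r] such that [a0 + (c1 a1 + d b) r] is a unit, and
  this unit lies in the ideal generated by [a0 + b (d r)] and [a1]. *)
Lemma stable_at1_2 (R : comPzRingType) : stable_at R 1 -> stable_at R 2.
Proof.
move=> st1 a b /unimodular_row_mx_scalar[c [d]].
rewrite !big_ord_recl big_ord0 addr0 => sum1.
set a0 := a 0 ord0 in sum1; set a1 := a 0 (lift _ _) in sum1.
set c0 := c 0 ord0 in sum1; set c1 := c 0 (lift _ _) in sum1.
have /st1[r [e]] : unimodular (row_mx (a0%:M : 'rV_1) (c1 * a1 + d * b)%:M).
  apply/unimodular_row_mx_scalar; exists c0%:M, 1.
  by rewrite big_ord1 !mxE mul1r addrA.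
rewrite big_ord1 !mxE /= => unit_e.
exists (\row_j if j == 0 then d * r 0 0 else 0).
exists (\row_j if j == 0 then e 0 0 else e 0 0 * c1 * r 0 0).
rewrite !big_ord_recl big_ord0 !mxE /= -/a0 -/a1 -unit_e.
ring.
Qed.

Lemma sr_le2_stable_at2 (R : comPzRingType) : sr_le R 2 -> stable_at R 2.
Proof.
by case=> -[|[|[|n]]] [[]] // _ st *; apply: stable_at1_2.
Qed.

(** The corner entry [v] is absorbed by moving the last column from [x] to
  [x + A r]. *)
Lemma extendable_simply (R : comPzRingType) (A : 'M[R]_2) :
  stable_at R 2 -> extendable A -> simply_extendable A.
Proof.
move=> st2 /extendableP[x [y [v detE]]]; apply/simply_extendableP.
have /st2[r [z sum1]] : unimodular (row_mx (\adj A *m x)^T (\det A)%:M).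
  apply/unimodular_row_mx_scalar; exists (- y), v.
  rewrite -detE -mulmxA addrC [in RHS]mxE -sumrN; congr (_ + _).
  by apply: eq_bigr => i _; rewrite mxE [_^T _ _]mxE mulNr.
exists (x + A *m r^T), z; rewrite -sum1 -mulmxA mxE.
rewrite mulmxDr mulmxA mul_adj_mx mul_scalar_mx.
by apply: eq_bigr => i _; rewrite !mxE.
Qed.

Theorem theorem1p6 (R : comPzRingType) (sr2 : sr_le R 2) :
  (forall A : 'M[R]_2, extendable A <-> simply_extendable A) /\
  (SE2_ring R <-> E2_ring R).
Proof.
have ext_iff (A : 'M[R]_2) : extendable A <-> simply_extendable A.
  split; first exact: extendable_simply (sr_le2_stable_at2 sr2).
  by case=> Ap [detAp ulAp _]; exists Ap.
by split=> //; split=> ext A /ext /ext_iff.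
Qed.
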